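(* Let $\mathcal{H}$ be a finite-dimensional Hilbert space with norm $\|\cdot\|$ and let $A:\mathcal{H}\to\mathbb{R}^m$ be linear. Let $\|\cdot\|_*$ be a norm on $\mathcal{H}$ whose unit ball $P=\{x : \|x\|_*\le1\}$ is a polytope, and let $\mathcal{C}$ be a (non-empty) union of faces of $P$. Suppose that for every $x_0\in\mathcal{C}$ the program $$\min_{x\in\mathcal{H}}\|x\|_*\quad\text{subject to}\quad Ax=Ax_0$$ recovers $x_0$, i.e. has $x_0$ as its unique solution. Then signals near the cone generated by $\mathcal{C}$ are stably and robustly recovered, in the following sense: for each face $F$ of $P$ contained in $\mathcal{C}$ there exist constants $\kappa_1,\kappa_2$ (depending only on $F$, $A$ and $\|\cdot\|_*$) such that for every nonzero $\check{x}_0\in\mathcal{H}$ whose normalized version $\check{x}_0/\|\check{x}_0\|_*$ lies closest to $F$ among the faces of $P$ contained in $\mathcal{C}$, every $\epsilon\ge0$ and every $n\in\mathbb{R}^m$ with $\|n\|_2\le\epsilon$, any solution $x^*$ of $$\min_{x\in\mathcal{H}}\|x\|_*\quad\text{subject to}\quad\|Ax-(A\check{x}_0+n)\|_2\le\epsilon$$ satisfies $$\|x^*-\check{x}_0\|\le\kappa_1\,\epsilon+\kappa_2\,\mathrm{dist}_{\|\cdot\|_*}(\check{x}_0,\mathrm{cone}(\mathcal{C})).$$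
   Context: $\|\cdot\|$ is the norm induced by the inner product of $\mathcal{H}$, $\|\cdot\|_2$ the Euclidean norm on $\mathbb{R}^m$. $\mathrm{cone}(\mathcal{C})=\{\lambda x_0 : \lambda>0,\ x_0\in\mathcal{C}\}$ and $\mathrm{dist}_{\|\cdot\|_*}(x,S)=\inf_{c\in S}\|x-c\|_*$. ''Lies closest to $F$'' means that $\mathrm{dist}_{\|\cdot\|_*}(\check{x}_0/\|\check{x}_0\|_*,F)\le\mathrm{dist}_{\|\cdot\|_*}(\check{x}_0/\|\check{x}_0\|_*,F')$ for every face $F'$ of $P$ contained in $\mathcal{C}$. *)

(* Defs.v *)
From HB Require Import structures.
From mathcomp Require Import all_boot all_order all_algebra.
From mathcomp Require Import all_classical all_reals.
Set Implicit Arguments.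
Unset Strict Implicit.
Unset Printing Implicit Defensive.
Import Order.TTheory GRing.Theory Num.Theory.
Local Open Scope classical_set_scope.
Local Open Scope ring_scope.

(* The scalars are the reals.  A finite-dimensional Hilbert space is a
   [vectType] over them with a positive definite symmetric bilinear form
   [ip : {dot H for idfun}]; completeness is automatic. *)
Definition ip_norm (R : realType) (H : vectType R) (ip : {dot H for idfun})
    (x : H) : R :=
  Num.sqrt (ip x x).

(* The library norm on matrices is the sup norm, hence this definition. *)
Definition l2norm (R : realType) (m : nat) (v : 'cV[R]_m) : R :=
  Num.sqrt (\sum_i v i 0 ^+ 2).

(* Nonnegativity and N 0 = 0 follow from these axioms. *)
Definition is_norm (R : realType) (H : vectType R) (N : H -> R) : Prop :=
  [/\ forall x y, N (x + y) <= N x + N y,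
      forall a x, N (a *: x) = `|a| * N x
    & forall x, N x = 0 -> x = 0].

Definition unit_ball (R : realType) (H : vectType R) (N : H -> R) : set H :=
  [set x | N x <= 1].

Definition conv_hull (R : realType) (H : vectType R) (s : seq H) : set H :=
  [set x | exists t : 'I_(size s) -> R,
     [/\ forall i, 0 <= t i, \sum_i t i = 1 & x = \sum_i t i *: s`_i]].

Definition is_polytope (R : realType) (H : vectType R) (P : set H) : Prop :=
  exists s : seq H, P = conv_hull s.

(* P itself is a face of P (take l = 0 and c = 0).  The empty set is not counted
   as a face: its distance to any point is +oo, so no point lies closest to it,
   whereas the real-valued [inf] of the empty set is 0. *)
Definition is_face (R : realType) (H : vectType R) (P F : set H) : Prop :=
  F !=set0 /\
  exists (l : {scalar H}) (c : R),
    (forall x, P x -> l x <= c) /\ F = P `&` [set x | l x = c].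

Definition is_union_of_faces (R : realType) (H : vectType R) (P C : set H)
    : Prop :=
  exists2 Fs : set (set H),
    (forall F, Fs F -> is_face P F) & C = \bigcup_(F in Fs) F.

Definition cone (R : realType) (H : vectType R) (C : set H) : set H :=
  [set x | exists (a : R) (x0 : H), [/\ 0 < a, C x0 & x = a *: x0]].

Definition dist (R : realType) (H : vectType R) (N : H -> R) (x : H)
    (S : set H) : R :=
  inf [set N (x - c) | c in S].

Definition is_solution (R : realType) (H : vectType R) (N : H -> R)
    (feasible : set H) (x : H) : Prop :=
  feasible x /\ forall y, feasible y -> N x <= N y.

Definition recovers (R : realType) (H : vectType R) (m : nat)
    (A : {linear H -> 'cV[R]_m}) (N : H -> R) (x0 : H) : Prop :=
  let sol := is_solution N [set x | A x = A x0] in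
  sol x0 /\ forall x, sol x -> x = x0.

Definition lies_closest (R : realType) (H : vectType R) (N : H -> R)
    (C F : set H) (z : H) : Prop :=
  forall F', is_face (unit_ball N) F' -> F' `<=` C ->
    dist N z F <= dist N z F'.

(* Main.v *)
Require Import Defs.
From HB Require Import structures.
From mathcomp Require Import all_boot all_order all_algebra.
From mathcomp Require Import all_classical all_reals.
From mathcomp Require Import lra ring.
Import Order.TTheory GRing.Theory Num.Theory.
Local Open Scope classical_set_scope.
Local Open Scope ring_scope.
Set Implicit Arguments.
Unset Strict Implicit.

(** Let [F] be a face all of whose points are recovered, and let [s] list
    points with convex hull the unit ball [P].  The heart of the matter is an
    inequality that is uniform over [f] in [F]:

      [|h| <= k1 |A h| + k2 g]   whenever [N (f + h) <= 1 + g] and [g >= 0].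

    Since [P] is the convex hull of [s], [N x] is the least total weight of a
    representation of [x] as a combination of [s] with nonnegative
    coefficients.  Write [f + h] in this way with weights [c], and [f] as a
    convex combination with weights [t].  As [F] is a face, [t] vanishes at the
    entries of [s] outside [F], so [d = c - t], which represents [h], is
    nonnegative there, and its total is [N (f + h) - 1].  So [d] satisfies the
    constraints

      [d_i >= 0] for [s_i] outside [F],  [sum d <= 0],  [A (sum d_i s_i) = 0],

    relaxed only by [g] and [A h].  The exact constraints force
    [sum d_i s_i = 0] ([synthesis_trivial]): starting from the average of the
    entries of [s] in [F], where all the weights of these entries are positive,
    a small step along [sum d_i s_i] would otherwise produce a second solution
    of the recovery program.  (This is for [F] in the unit sphere; the only other
    face is [P] itself, and recovery of all its points makes [A] injective.)
    Hence any linear functional of [sum d_i s_i] is nonpositive under the exact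
    constraints, and Farkas' lemma ([farkas]) writes it as a nonnegative combination of the constraints.  This is the desired
    bound for one functional ([functional_bound]); applying it to the
    coordinate functionals gives the bound on the norm ([ip_norm_bound]).

    Now let [x0] be a signal, [z] its normalization, [xs] a solution of the
    noisy program, and [f] in [F].  Since [x0] is feasible, [N xs <= N x0], and
    then [h = (xs - x0) / N x0] satisfies [N (f + h) <= 1 + N (z - f)], while
    [A (xs - x0)] is of size at most [2 eps].  The inequality bounds the error
    by a multiple of [eps] plus a multiple of [N x0 * N (z - f)]
    ([error_bound]); taking the infimum over [f] leaves the distance from [z]
    to [F].  It is no larger than the distance from [z] to any other face
    contained in [C], and replacing a point of the unit sphere by the ray through
    it at most halves its distance to [z] ([dist_face_le_dist_cone]). *)

(** * Farkas' lemma *)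

Lemma scalar_map0 (R : realFieldType) (V : lmodType R) (f : V -> R) :
  scalar f -> f 0 = 0.
Proof. by move=> lf; have := lf (-1) 0 0; rewrite scaler0 addr0; lra. Qed.

Lemma scalar_mapZ (R : realFieldType) (V : lmodType R) (f : V -> R) c x :
  scalar f -> f (c *: x) = c * f x.
Proof. by move=> lf; have := lf c x 0; rewrite !addr0 (scalar_map0 lf) addr0. Qed.

(** Bartl's proof, by induction on the number of inequalities.  If [b] is not
    already a consequence of the tail [r], some [u] satisfies the inequalities
    of [r] but has [b u > 0], hence also [a j u > 0].  Composing all the
    functionals with the projection onto the kernel of [a j] along [u] makes the
    tail alone imply the inequality for [b]; the multiplier of [a j] is then
    read off at [u], and it is positive because of the signs of the values at
    [u]. *)
Lemma farkas (R : realFieldType) (V : lmodType R) (I : eqType) (r : seq I)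
    (a : I -> V -> R) (b : V -> R) :
  uniq r -> (forall i, scalar (a i)) -> scalar b ->
  (forall x, (forall i, i \in r -> a i x <= 0) -> b x <= 0) ->
  exists2 y : I -> R, forall i, 0 <= y i &
    forall x, b x = \sum_(i <- r) y i * a i x.
Proof.
elim: r a b => [|j r IHr] a b /=.
  move=> _ _ lin_b b_le0; exists (fun=> 0) => // x; rewrite big_nil.
  have bNx : b (- x) = - b x by rewrite -scaleN1r scalar_mapZ // mulN1r.
  have xle : b x <= 0 by exact: b_le0.
  have Nxle : b (- x) <= 0 by exact: b_le0.
  by move: Nxle; rewrite bNx; lra.
case/andP=> jr uniq_r lin_a lin_b b_le0.
have [implied|/existsNP[u0 /not_implyP[u0_le0 /negP bu0]]] :=
    pselect (forall x, (forall i, i \in r -> a i x <= 0) -> b x <= 0).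
  have [y y_ge0 by_] := IHr a b uniq_r lin_a lin_b implied.
  exists (fun i => if i == j then 0 else y i) => [i|x]; first by case: ifP.
  rewrite big_cons eqxx mul0r add0r by_.
  by apply: eq_big_seq => i ir; case: eqP => // eij; rewrite -eij ir in jr.
have {}bu0 : 0 < b u0 by rewrite ltNge.
have au0 : 0 < a j u0.
  rewrite ltNge; apply/negP => aju0; move: bu0; apply/negP; rewrite -leNgt.
  by apply: b_le0 => i; rewrite inE => /predU1P[->|/u0_le0].
pose u := (a j u0)^-1 *: u0.
have aju : a j u = 1 by rewrite scalar_mapZ // mulVf // gt_eqF.
have bu : 0 < b u by rewrite scalar_mapZ // mulr_gt0 // invr_gt0.
have u_le0 i : i \in r -> a i u <= 0.
  by move=> ir; rewrite scalar_mapZ // pmulr_rle0 ?invr_gt0 ?u0_le0.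
(* [tilt f] is [f] composed with the projection onto the kernel of [a j] along [u]. *)
pose tilt (f : V -> R) x := f x - f u * a j x.
have lin_tilt f : scalar f -> scalar (tilt f).
  by move=> lf c x y; rewrite /tilt lf lin_a; ring.
have tiltE f x : scalar f -> tilt f x = f (- a j x *: u + x).
  by move=> lf; rewrite /tilt lf; ring.
have [|y y_ge0 tilt_b] := IHr (fun i => tilt (a i)) (tilt b) uniq_r
    (fun i => lin_tilt _ (lin_a i)) (lin_tilt _ lin_b).
  move=> x tilt_le0; rewrite tiltE //; apply: b_le0 => i.
  rewrite inE => /predU1P[->|ir]; last by rewrite -tiltE // tilt_le0.
  by rewrite lin_a aju; lra.
pose yj := b u - \sum_(i <- r) y i * a i u.
exists (fun i => if i == j then yj else y i) => [i|x].
  case: ifP => // _; rewrite subr_ge0 (le_trans _ (ltW bu)) // big_seq.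
  by apply: sumr_le0 => k kr; rewrite mulr_ge0_le0 ?u_le0.
have := tilt_b x; rewrite /tilt => bE.
rewrite big_cons eqxx [X in _ + X](_ : _ = \sum_(i <- r) y i * a i x); last first.
  by apply: eq_big_seq => i ir; case: eqP => // eij; rewrite -eij ir in jr.
have -> : \sum_(i <- r) y i * a i x =
    \sum_(i <- r) y i * (a i x - a i u * a j x)
    + (\sum_(i <- r) y i * a i u) * a j x.
  by rewrite mulr_suml -big_split; apply: eq_bigr => i _ /=; ring.
by rewrite -bE /yj; ring.
Qed.

(** * Norms whose unit ball is a convex hull *)

Section Norms.
Variables (R : realType) (H : vectType R) (N : H -> R).
Hypothesis hN : is_norm N.

Lemma norm_add x y : N (x + y) <= N x + N y. Proof. by case: hN. Qed.
Lemma norm_scale a x : N (a *: x) = `|a| * N x. Proof. by case: hN. Qed.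
Lemma norm_eq0 x : N x = 0 -> x = 0. Proof. by case: hN => _ _; apply. Qed.

Lemma norm0 : N 0 = 0.
Proof. by rewrite -(scale0r 0) norm_scale normr0 mul0r. Qed.

Lemma normN x : N (- x) = N x.
Proof. by rewrite -scaleN1r norm_scale normrN1 mul1r. Qed.

Lemma norm_ge0 x : 0 <= N x.
Proof. by have := norm_add x (- x); rewrite subrr norm0 normN; lra. Qed.

Lemma norm_gt0 x : x != 0 -> 0 < N x.
Proof.
move=> x0; rewrite lt_def norm_ge0 andbT.
by apply: contra x0 => /eqP/norm_eq0 ->.
Qed.

Lemma norm_normalize x : x != 0 -> N ((N x)^-1 *: x) = 1.
Proof.
move=> /norm_gt0 Nx; rewrite norm_scale ger0_norm ?invr_ge0 ?norm_ge0 //.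
by rewrite mulVf // gt_eqF.
Qed.

Lemma norm_sum (I : finType) (f : I -> H) : N (\sum_i f i) <= \sum_i N (f i).
Proof.
elim/big_rec2: _ => [|i y x _ IH]; first by rewrite norm0.
by rewrite (le_trans (norm_add _ _)) // lerD2l.
Qed.

Variable s : seq H.
Hypothesis hs : unit_ball N = conv_hull s.

Lemma vertex_in_ball (i : 'I_(size s)) : N s`_i <= 1.
Proof.
suff : unit_ball N s`_i by [].
rewrite hs; exists (fun j => (j == i)%:R); split=> [j||].
- by rewrite ler0n.
- by rewrite (bigD1 i) //= eqxx big1 ?addr0 // => j /negPf->.
rewrite (bigD1 i) //= eqxx scale1r big1 ?addr0 // => j /negPf->.
by rewrite scale0r.
Qed.

Lemma norm_conic_comb (c : 'I_(size s) -> R) : (forall i, 0 <= c i) ->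
  N (\sum_i c i *: s`_i) <= \sum_i c i.
Proof.
move=> c_ge0; apply: le_trans (norm_sum _) _; apply: ler_sum => i _.
by rewrite norm_scale ger0_norm // ler_piMr // vertex_in_ball.
Qed.

(** The norm is the least total weight of a nonnegative combination of [s];
    [norm_conic_comb] is the other half of this fact. *)
Lemma norm_atomic x : exists c : 'I_(size s) -> R,
  [/\ forall i, 0 <= c i, \sum_i c i = N x & x = \sum_i c i *: s`_i].
Proof.
have [->|x0] := eqVneq x 0.
  exists (fun=> 0); split=> //; first by rewrite big1 ?norm0.
  by rewrite big1 // => i _; rewrite scale0r.
have : unit_ball N ((N x)^-1 *: x) by rewrite /unit_ball /= norm_normalize.
rewrite hs => -[t [t_ge0 t1 xE]]; exists (fun i => N x * t i); split=> [i||].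
- by rewrite mulr_ge0 ?norm_ge0.
- by rewrite -mulr_sumr t1 mulr1.
under eq_bigr do rewrite -scalerA.
by rewrite -scaler_sumr -xE scalerA divff ?scale1r // gt_eqF // norm_gt0.
Qed.
End Norms.


(** * Comparison of the Hilbert norm with coordinates *)

(** Expanding [ip h h] in a basis, [K ^+ 2] can be the sum of the absolute values
    of the entries of the Gram matrix. *)
Lemma ip_norm_le_coord (R : realType) (H : vectType R) (ip : {dot H for idfun}) :
  exists2 K : R, 0 <= K &
    forall h, ip_norm ip h <= K * \sum_i `|coord (vbasis fullv) i h|.
Proof.
pose b (i : 'I_(\dim (fullv : {vspace H}))) : H := (vbasis fullv)`_i.
pose M := \sum_i \sum_j `|ip (b i) (b j)|.
have M_ge0 : 0 <= M by apply: sumr_ge0 => i _; apply: sumr_ge0.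
exists (Num.sqrt M) => [|h]; first exact: sqrtr_ge0.
set S := \sum_i _; have S_ge0 : 0 <= S by apply: sumr_ge0.
rewrite -[S]ger0_norm // -sqrtr_sqr -sqrtrM // /ip_norm ler_wsqrtr //.
have xS i : `|coord (vbasis fullv) i h| <= S.
  by rewrite /S (bigD1 i) //= ler_wpDr ?sumr_ge0.
rewrite [in leLHS](coord_vbasis (memvf h)) linear_sumlz.
rewrite /M mulr_suml; apply: ler_sum => i _.
rewrite linear_sumr mulr_suml; apply: ler_sum => j _ /=.
rewrite linearZl_LR linearZr /=.
apply: le_trans (ler_norm _) _; rewrite !normrM.
rewrite mulrA mulrC ler_wpM2l // expr2 ler_pM //.
Qed.

(** * Faces and exact recovery *)

Section Faces.
Variables (R : realType) (H : vectType R) (N : H -> R).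
Hypothesis hN : is_norm N.
Variable F : set H.
Hypothesis hF : is_face (unit_ball N) F.

Lemma face_sub_ball f : F f -> N f <= 1.
Proof. by case: hF => _ [l [c [_ ->]]] []. Qed.

(** By symmetry of the ball, a supporting functional with maximum 0 vanishes on
    the whole ball; one with positive maximum attains it only on the sphere. *)
Lemma face_sphere_or_ball : (forall f, F f -> N f = 1) \/ unit_ball N `<=` F.
Proof.
case: hF => _ [l [c [l_le FE]]].
have c_ge0 : 0 <= c.
  by have := l_le 0; rewrite linear0; apply; rewrite /unit_ball /= norm0 // ler01.
have [c0|c_neq0] := eqVneq c 0; [right|left].
  move=> x Px; rewrite FE; split=> //=; apply/le_anti/andP; split; first exact: l_le.
  have := l_le (- x); rewrite linearN /= /unit_ball /= normN // c0 => /(_ Px).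
  by rewrite oppr_le0.
rewrite FE => f [/= Nf lf].
have f0 : f != 0 by apply: contra c_neq0 => /eqP f0; rewrite -lf f0 linear0.
have Nf_gt0 := norm_gt0 hN f0.
apply/le_anti/andP; split=> //.
have /l_le : unit_ball N ((N f)^-1 *: f).
  by rewrite /unit_ball /= norm_normalize.
have c_gt0 : 0 < c by rewrite lt_def c_neq0.
by rewrite linearZ /= lf mulrC ler_pdivrMr // ler_pMr.
Qed.

Variable s : seq H.
Hypothesis hs : unit_ball N = conv_hull s.

(** The nonnegative gaps [c - l s_i] of the supporting functional have weighted
    average zero. *)
Lemma face_weights (t : 'I_(size s) -> R) :
  (forall i, 0 <= t i) -> \sum_i t i = 1 -> F (\sum_i t i *: s`_i) ->
  forall i : 'I_(size s), s`_i \notin F -> t i = 0.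
Proof.
case: hF => _ [l [c [l_le FE]]] t_ge0 t1; rewrite FE => -[_ /= lf] i.
have gap_ge0 j : 0 <= t j * (c - l s`_j).
  by rewrite mulr_ge0 // subr_ge0 l_le //; apply: (@vertex_in_ball _ _ _ s).
have : \sum_j t j * (c - l s`_j) = 0.
  under eq_bigr do rewrite mulrBr.
  rewrite sumrB -mulr_suml t1 mul1r -lf linear_sum /=.
  by apply/eqP; rewrite subr_eq0; apply/eqP/eq_bigr => j _; rewrite linearZ.
move/eqP; rewrite psumr_eq0 // => /allP/(_ i (mem_index_enum _)) /=.
rewrite mulf_eq0 => /orP[/eqP//|/eqP ci]; rewrite notin_setE => -[].
by split; [exact: (@vertex_in_ball _ _ _ s)|rewrite /=; lra].
Qed.

Definition face_vertices : {set 'I_(size s)} := [set i : 'I_(size s) | s`_i \in F]%SET.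

(** A point of the relative interior of the face: all its entries of [s] carry
    a positive weight, which leaves room to perturb these weights. *)
Definition face_center : H :=
  \sum_i ((i \in face_vertices)%:R / #|face_vertices|%:R) *: s`_i.

Lemma face_vertices_gt0 : (0 < #|face_vertices|)%N.
Proof.
rewrite lt0n; apply/negP; rewrite cards_eq0 => /eqP I0.
case: hF => -[f Ff] _.
have : unit_ball N f by exact: face_sub_ball.
rewrite hs => -[t [t_ge0 t1 fE]]; rewrite fE in Ff.
have := oner_neq0 R; rewrite -t1 big1 ?eqxx // => i _.
apply: face_weights => //; have : i \notin face_vertices by rewrite I0 inE.
by rewrite inE.
Qed.

Lemma face_center_in : F face_center.
Proof.
have I_gt0 : 0 < #|face_vertices|%:R :> R by rewrite ltr0n face_vertices_gt0.
have w1 : \sum_(i < size s)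
    ((i \in face_vertices)%:R / #|face_vertices|%:R) = 1 :> R.
  rewrite -mulr_suml -natr_sum -[X in X%:R / _]big_mkcond /= sum1_card divff //.
  by rewrite gt_eqF.
case: (hF) => _ [l [c [_ FE]]]; rewrite FE; split=> /=.
  rewrite hs; eexists; split; [|exact: w1|reflexivity] => i.
  by rewrite divr_ge0 ?ler0n.
rewrite /face_center linear_sum -[RHS]mul1r -[X in _ = X * _]w1 mulr_suml.
apply: eq_bigr => i _; rewrite linearZ /=.
case: (boolP (i \in _)); last by rewrite !mul0r.
by rewrite inE FE => /set_mem[_ /= ->].
Qed.

Variables (m : nat) (A : {linear H -> 'cV[R]_m}).
Hypothesis recF : forall f, F f -> recovers A N f.

(** On a face in the sphere this is uniqueness of the solution at [f].  If the
    face is the whole ball, even a normalized kernel vector is recovered; but 0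
    is feasible for it and has smaller norm. *)
Lemma kernel_descent_trivial f w tau : F f -> A w = 0 -> 0 < tau ->
  N (f + tau *: w) <= 1 -> w = 0.
Proof.
move=> Ff Aw tau_gt0 Nle1; apply/eqP; case: face_sphere_or_ball => [F1|subF].
  have [[_ f_min] f_uniq] := recF Ff.
  have : f + tau *: w = f.
    apply: f_uniq; split; first by rewrite /= linearD linearZ /= Aw scaler0 addr0.
    by move=> y Ay; apply: le_trans Nle1 _; rewrite -(F1 f Ff) f_min.
  by move/eqP; rewrite -subr_eq0 addrC addKr scaler_eq0 gt_eqF.
apply/negPn/negP => w_neq0.
have /recF[[_ min0] _] : F ((N w)^-1 *: w).
  by apply: subF; rewrite /unit_ball /= norm_normalize.
have := min0 0; rewrite /= linear0 linearZ /= Aw scaler0 => /(_ erefl).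
by rewrite norm_normalize // norm0 // ler10.
Qed.

Definition synthesis (d : 'rV[R]_(size s)) : H := \sum_i d 0 i *: s`_i.

Lemma synthesis_linear : linear synthesis.
Proof.
move=> a u v; rewrite /synthesis scaler_sumr -big_split; apply: eq_bigr => i _ /=.
by rewrite !mxE scalerDl scalerA.
Qed.

(** The perturbed point is rescaled so that no small parameter is needed:
    adding the large multiple [M * k] of the center makes all the weights
    nonnegative, without raising the total weight above [M * k]. *)
Lemma synthesis_trivial (d : 'rV[R]_(size s)) :
  (forall i, i \notin face_vertices -> 0 <= d 0 i) ->
  \sum_i d 0 i <= 0 -> A (synthesis d) = 0 -> synthesis d = 0.
Proof.
move=> d_ge0 d_le0 Ad.
pose k : R := #|face_vertices|%:R.
have k_gt0 : 0 < k by rewrite ltr0n face_vertices_gt0.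
pose M := 1 + \sum_i `|d 0 i|.
have M_gt0 : 0 < M by rewrite ltr_pwDl // sumr_ge0.
have dM i : - M <= d 0 i.
  rewrite /M (bigD1 i) //=; have := lerNnormlW (lexx `|d 0 i|).
  have : 0 <= \sum_(j | j != i) `|d 0 j| by apply: sumr_ge0.
  lra.
pose c i := M * (i \in face_vertices)%:R + d 0 i.
have c_ge0 i : 0 <= c i.
  rewrite /c; case: (boolP (i \in _)) => iI; last by rewrite mulr0 add0r d_ge0.
  by rewrite mulr1 -[X in X + _]opprK addrC subr_ge0.
have cE : \sum_i c i *: s`_i = (M * k) *: face_center + synthesis d.
  rewrite /synthesis /face_center scaler_sumr -big_split; apply: eq_bigr => i _ /=.
  by rewrite scalerA -scalerDl; congr (_ *: _); rewrite /c; field; rewrite gt_eqF.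
have c_sum : \sum_i c i <= M * k.
  by rewrite big_split /= -mulr_sumr -natr_sum -big_mkcond sum1_card -/k gerDl.
apply: (@kernel_descent_trivial face_center _ (M * k)^-1) => //.
- exact: face_center_in.
- by rewrite invr_gt0 mulr_gt0.
have Mk_gt0 : 0 < M * k by rewrite mulr_gt0.
have -> : face_center + (M * k)^-1 *: synthesis d = (M * k)^-1 *: \sum_i c i *: s`_i.
  by rewrite cE scalerDr scalerA mulVf ?scale1r // lt0r_neq0.
rewrite norm_scale // gtr0_norm ?invr_gt0 // ler_pdivrMl // mulr1.
apply: le_trans c_sum; exact: norm_conic_comb.
Qed.

(** Farkas' lemma is applied in the space of weights, where both the norm and
    membership in the face are described by finitely many inequalities.  Each
    constraint is bounded along [c - t] separately, so that its multiplier goes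
    to the coefficient of the residual, of the excess [g], or of neither. *)
Lemma functional_bound (e : H -> R) : scalar e ->
  exists k1 k2 : R, [/\ 0 <= k1, 0 <= k2 & forall f h g, F f ->
    N (f + h) <= 1 + g -> e h <= k1 * (\sum_r `|A h r 0|) + k2 * g].
Proof.
move=> lin_e.
(* The equation [A (synthesis d) = 0] is encoded as two inequalities for each
   coordinate; a sign-free weight gives the trivial constraint 0. *)
pose a (j : (bool * 'I_m) + option 'I_(size s)) d : R := match j with
  | inl (b, r) => (-1) ^+ b * A (synthesis d) r 0
  | inr None => \sum_i d 0 i
  | inr (Some i) => if i \in face_vertices then 0 else - d 0 i
  end.
have lin_a j : scalar (a j).
  move=> c u v; case: j => [[b r]|[i|]] /=.
  - by rewrite synthesis_linear linearP !mxE mulrDr mulrCA.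
  - by case: ifP => _; rewrite ?mxE; ring.
  - by rewrite mulr_sumr -big_split; apply: eq_bigr => i _; rewrite !mxE.
have [| |y y_ge0 eE] :=
    @farkas R _ _ (index_enum _) a (e \o synthesis) (index_enum_uniq _) lin_a.
- by move=> c u v /=; rewrite synthesis_linear lin_e.
- move=> d a_le0 /=; rewrite synthesis_trivial ?(scalar_map0 lin_e) //.
  + move=> i iI; have := a_le0 (inr (Some i)) (mem_index_enum _).
    by rewrite /= (negPf iI) oppr_le0.
  + exact: (a_le0 (inr None) (mem_index_enum _)).
  apply/colP => r; rewrite mxE; apply/le_anti/andP; split.
    by have := a_le0 (inl (false, r)) (mem_index_enum _); rewrite /= mul1r.
  by have := a_le0 (inl (true, r)) (mem_index_enum _); rewrite /= mulN1r oppr_le0.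
(* Each constraint is at most [p j * |A h| + q j * g] along [c - t]. *)
pose p (j : (bool * 'I_m) + option 'I_(size s)) : R := if j is inl _ then 1 else 0.
pose q (j : (bool * 'I_m) + option 'I_(size s)) : R := if j is inr None then 1 else 0.
exists (\sum_j y j * p j), (\sum_j y j * q j).
split=> [||f h g Ff fh_le].
- by apply: sumr_ge0 => -[?|?] _; rewrite mulr_ge0.
- by apply: sumr_ge0 => -[?|[?|]] _; rewrite mulr_ge0.
have : unit_ball N f by exact: face_sub_ball.
rewrite hs => -[t [t_ge0 t1 fE]].
have [c [c_ge0 c_sum fhE]] := norm_atomic hN hs (f + h).
pose d := \row_i (c i - t i).
have hE : h = synthesis d.
  rewrite /synthesis; under eq_bigr do rewrite mxE scalerBl.
  by rewrite sumrB -fhE -fE addrC addKr.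
have d_sum : \sum_i d 0 i = N (f + h) - 1.
  by under eq_bigr do rewrite mxE; rewrite sumrB c_sum t1.
rewrite hE -[e _]/((e \o synthesis) d) eE !mulr_suml -big_split.
apply: ler_sum => j _ /=; rewrite -!mulrA -mulrDr ler_wpM2l // -hE.
case: j => [[b r]|[i|]] /=; rewrite ?mul1r ?mul0r ?addr0 ?add0r.
- rewrite -hE (bigD1 r) //= ler_wpDr ?sumr_ge0 //.
  by rewrite (le_trans (ler_norm _)) // normrM normr_sign mul1r.
- case: ifP => // /negbT; rewrite inE mxE => iF.
  by rewrite (@face_weights t) ?subr0 ?oppr_le0 // -fE.
- by rewrite d_sum lerBlDl.
Qed.

(** Adding the bounds for [e] and [- e] requires both to be nonnegative, whence
    the hypothesis on [g]. *)
Lemma functional_abs_bound (e : H -> R) : scalar e ->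
  exists k1 k2 : R, [/\ 0 <= k1, 0 <= k2 & forall f h g, F f -> 0 <= g ->
    N (f + h) <= 1 + g -> `|e h| <= k1 * (\sum_r `|A h r 0|) + k2 * g].
Proof.
move=> lin_e; have [k1 [k2 [k1_ge0 k2_ge0 bnd]]] := functional_bound lin_e.
have [|k1' [k2' [k1'_ge0 k2'_ge0 bnd']]] := @functional_bound (fun h => - e h).
  by move=> a u v; rewrite lin_e; ring.
exists (k1 + k1'), (k2 + k2'); split; rewrite ?addr_ge0 // => f h g Ff g_ge0 fh_le.
have := bnd f h g Ff fh_le; have := bnd' f h g Ff fh_le.
set S := \sum_r _; have S_ge0 : 0 <= S by apply: sumr_ge0.
have [*] : [/\ 0 <= k1 * S, 0 <= k2 * g, 0 <= k1' * S & 0 <= k2' * g].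
  by rewrite !mulr_ge0.
by rewrite !mulrDl; case: ler0P; lra.
Qed.

Lemma ip_norm_bound (ip : {dot H for idfun}) :
  exists k1 k2 : R, [/\ 0 <= k1, 0 <= k2 & forall f h g, F f -> 0 <= g ->
    N (f + h) <= 1 + g -> ip_norm ip h <= k1 * (\sum_r `|A h r 0|) + k2 * g].
Proof.
have [K K_ge0 ip_le] := ip_norm_le_coord ip.
have /choice[k kP] : forall i, exists k : R * R, [/\ 0 <= k.1, 0 <= k.2 &
    forall f h g, F f -> 0 <= g -> N (f + h) <= 1 + g ->
    `|coord (vbasis fullv) i h| <= k.1 * (\sum_r `|A h r 0|) + k.2 * g].
  move=> i; have [|k1 [k2 k12]] := @functional_abs_bound (coord (vbasis fullv) i).
    by move=> a u v; rewrite linearP.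
  by exists (k1, k2).
exists (K * \sum_i (k i).1), (K * \sum_i (k i).2); split=> [||f h g Ff g_ge0 fh_le].
- by rewrite mulr_ge0 // sumr_ge0 // => i _; have [] := kP i.
- by rewrite mulr_ge0 // sumr_ge0 // => i _; have [] := kP i.
apply: le_trans (ip_le h) _; rewrite -!mulrA -mulrDr ler_wpM2l //.
rewrite !mulr_suml -big_split; apply: ler_sum => i _ /=.
by have [_ _ ub] := kP i; apply: (ub f).
Qed.
End Faces.

(** * Distance to the cone *)

Section Distance.
Variables (R : realType) (H : vectType R) (N : H -> R).
Hypothesis hN : is_norm N.

Lemma dist_le x (S : set H) c : S c -> dist N x S <= N (x - c).
Proof.
move=> Sc; apply: ge_inf; last by exists c.
by exists 0 => _ [y _ <-]; apply: norm_ge0.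
Qed.

Lemma le_dist x (S : set H) b :
  S !=set0 -> (forall c, S c -> b <= N (x - c)) -> b <= dist N x S.
Proof.
move=> [c Sc] b_le; apply: lb_le_inf; first by exists (N (x - c)), c.
by move=> _ [y Sy <-]; apply: b_le.
Qed.

(** Moving from [a *: c] back to [c] costs [|a - 1|], the difference of the norms
    of [a *: c] and [z]. *)
Lemma dist_sphere_ray z c a : N z = 1 -> N c = 1 -> 0 < a ->
  N (z - c) <= 2 * N (z - a *: c).
Proof.
move=> z1 c1 a_gt0.
have ac : N (a *: c) = a by rewrite norm_scale // c1 mulr1 gtr0_norm.
have tri1 := norm_add hN (z - a *: c) ((a - 1) *: c).
have tri2 := norm_add hN (z - a *: c) (a *: c).
have tri3 := norm_add hN (a *: c - z) z.
have : N ((a - 1) *: c) = `|a - 1| by rewrite norm_scale // c1 mulr1.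
have opp : N (a *: c - z) = N (z - a *: c) by rewrite -normN // opprB.
move: tri1 tri2 tri3; rewrite !subrK opp ac z1.
have -> : z - a *: c + (a - 1) *: c = z - c.
  by rewrite scalerBl scale1r addrA subrK.
by case: ler0P; lra.
Qed.

(** A point of [C] lies in a face contained in [C], to which [dist_sphere_ray]
    applies if the face is contained in the sphere; otherwise the face contains
    the whole ball, and then [z] is at distance 0 from it. *)
Lemma dist_face_le_dist_cone (C F : set H) x :
  C !=set0 -> is_union_of_faces (unit_ball N) C -> x != 0 ->
  lies_closest N C F ((N x)^-1 *: x) ->
  N x * dist N ((N x)^-1 *: x) F <= 2 * dist N x (cone C).
Proof.
move=> [c0 Cc0] [Fs Fs_face CE] x0 closest; set z := _ *: x.
have Nx := norm_gt0 hN x0.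
have z1 : N z = 1 by apply: norm_normalize.
have xz : x = N x *: z by rewrite scalerA divff ?scale1r // gt_eqF.
suff : N x * dist N z F / 2 <= dist N x (cone C) by lra.
apply: le_dist => [|_ [a [c [a_gt0 Cc ->]]]]; first by exists (1 *: c0), 1, c0.
move: Cc; rewrite CE => -[F' FsF' F'c].
have F'_face := Fs_face F' FsF'.
have F'C : F' `<=` C by rewrite CE; apply: bigcup_sup.
have zF' : dist N z F <= dist N z F' by apply: closest.
have ray : N (x - a *: c) = N x * N (z - (a / N x) *: c).
  rewrite -[X in X * N _]gtr0_norm // -norm_scale // scalerBr -xz scalerA.
  by rewrite mulrCA divff ?mulr1 // gt_eqF.
rewrite ray -mulrA ler_pM2l //.
suff : dist N z F <= 2 * N (z - (a / N x) *: c) by lra.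
have [F'1|subF'] := face_sphere_or_ball hN F'_face.
  apply: le_trans zF' _; apply: le_trans (dist_le z F'c) _.
  by apply: dist_sphere_ray; [| exact: F'1 | exact: divr_gt0].
apply: le_trans zF' _; apply: le_trans (@dist_le z F' z _) _.
  by apply: subF'; rewrite /unit_ball /= z1.
by rewrite subrr norm0 // mulr_ge0 ?norm_ge0.
Qed.
End Distance.

(** * Stable and robust recovery *)

Lemma ler_coord_l2norm (R : realType) (m : nat) (v : 'cV[R]_m) r :
  `|v r 0| <= l2norm v.
Proof.
rewrite -sqrtr_sqr /l2norm ler_wsqrtr // (bigD1 r) //= ler_wpDr //.
by apply: sumr_ge0 => i _; rewrite sqr_ge0.
Qed.

Lemma l2normN (R : realType) (m : nat) (v : 'cV[R]_m) : l2norm (- v) = l2norm v.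
Proof. by congr Num.sqrt; apply: eq_bigr => i _; rewrite mxE sqrrN. Qed.

(** Everything is divided by [N x0], because the inequality on the face is stated
    at points of the face itself and not of its cone. *)
Lemma error_bound (R : realType) (H : vectType R) (ip : {dot H for idfun})
    (m : nat) (A : {linear H -> 'cV[R]_m}) (N : H -> R) (hN : is_norm N)
    (F : set H) (k1 k2 : R) (x0 : H) (eps : R) (n : 'cV[R]_m) (xs f : H) :
  0 <= k1 ->
  (forall f h g, F f -> 0 <= g -> N (f + h) <= 1 + g ->
    ip_norm ip h <= k1 * (\sum_r `|A h r 0|) + k2 * g) ->
  x0 != 0 -> l2norm n <= eps ->
  is_solution N [set x | l2norm (A x - (A x0 + n)) <= eps] xs ->
  F f ->
  ip_norm ip (xs - x0) <=
    k1 * (m%:R * (2 * eps)) + k2 * (N x0 * N ((N x0)^-1 *: x0 - f)).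
Proof.
move=> k1_ge0 bnd x0_neq0 n_le [/= xs_feas xs_min] Ff.
set rho := N x0; have rho_gt0 : 0 < rho by apply: norm_gt0.
set D := N _; pose h := xs - x0.
have xs_le : N xs <= rho by apply: xs_min; rewrite opprD addNKr l2normN.
have ip_scale : ip_norm ip h = rho * ip_norm ip (rho^-1 *: h).
  rewrite /ip_norm linearZl_LR linearZr /= mulrA sqrtrM ?mulr_ge0 ?invr_ge0 ?ltW //.
  by rewrite -expr2 sqrtr_sqr ger0_norm ?invr_ge0 ?ltW // mulVKf // gt_eqF.
have fh_le : N (f + rho^-1 *: h) <= 1 + D.
  have -> : f + rho^-1 *: h = rho^-1 *: xs + (f - rho^-1 *: x0).
    by rewrite scalerBr addrCA.
  apply: le_trans (norm_add hN _ _) _.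
  rewrite -[N (f - _)]normN // opprB lerD2r norm_scale // gtr0_norm ?invr_gt0 //.
  by rewrite ler_pdivrMl // mulr1.
have Ah_le r : `|A h r 0| <= 2 * eps.
  have -> : A h r 0 = (A xs - (A x0 + n)) r 0 + n r 0.
    by rewrite linearB !mxE; ring.
  apply: le_trans (ler_normD _ _) _.
  have := ler_coord_l2norm (A xs - (A x0 + n)) r; have := ler_coord_l2norm n r.
  lra.
have Ah_sum : \sum_r `|A h r 0| <= m%:R * (2 * eps).
  apply: le_trans (ler_sum _ (fun r _ => Ah_le r)) _.
  by rewrite sumr_const card_ord [m%:R * _]mulr_natl.
have D_ge0 : 0 <= D by apply: norm_ge0.
have := bnd f (rho^-1 *: h) D Ff D_ge0 fh_le.
rewrite -(ler_pM2l rho_gt0) -ip_scale => /le_trans; apply.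
under eq_bigr do rewrite linearZ mxE normrM gtr0_norm ?invr_gt0 //.
rewrite -mulr_sumr mulrDr mulrCA mulVKf ?gt_eqF // lerD ?ler_wpM2l //.
by rewrite mulrCA.
Qed.


Unset Implicit Arguments.

Theorem corollary15 (R : realType) (H : vectType R) (ip : {dot H for idfun})
    (m : nat) (A : {linear H -> 'cV[R]_m}) (N : H -> R) (hN : is_norm N)
    (hP : is_polytope (unit_ball N))
    (F : set H) (hF : is_face (unit_ball N) F) :
  exists kappa1 kappa2 : R,
    forall C : set H,
      C !=set0 ->
      is_union_of_faces (unit_ball N) C ->
      (forall x0, C x0 -> recovers A N x0) ->
      F `<=` C ->
      forall x0 : H,
        x0 != 0 ->
        lies_closest N C F ((N x0)^-1 *: x0) ->
        forall (eps : R) (n : 'cV[R]_m),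
          0 <= eps ->
          l2norm n <= eps ->
          forall xs : H,
            is_solution N [set x | l2norm (A x - (A x0 + n)) <= eps] xs ->
            ip_norm ip (xs - x0) <= kappa1 * eps + kappa2 * dist N x0 (cone C).
Proof.
(* The constants are chosen before [C]; every admissible [C] makes all the points
   of [F] recovered, so if they are not, there is no such [C]. *)
have [recF|not_recF] := pselect (forall f, F f -> recovers A N f); last first.
  exists 0, 0 => C _ _ recC FC; case: not_recF => f /FC; exact: recC.
have [s hs] := hP.
have [k1 [k2 [k1_ge0 k2_ge0 bnd]]] :=
  ip_norm_bound hN hF hs recF ip.
(* [k2 + 1] is positive, so that the bound for each [f] can be divided by it
   before taking the infimum. *)
exists (k1 * (m%:R * 2)), ((k2 + 1) * 2).
move=> C C_neq0 C_faces _ _ x0 x0_neq0 closest eps n _ n_le xs xs_sol.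
have rho_gt0 := norm_gt0 hN x0_neq0.
have err f := error_bound hN k1_ge0 bnd x0_neq0 n_le xs_sol (f := f).
have cone_le := dist_face_le_dist_cone hN C_neq0 C_faces x0_neq0 closest.
set z := _ *: x0 in cone_le closest err; set E := ip_norm _ _ in err *.
have w_gt0 : 0 < (k2 + 1) * N x0 by rewrite mulr_gt0 // ltr_wpDl.
have : (E - k1 * (m%:R * (2 * eps))) / ((k2 + 1) * N x0) <= dist N z F.
  apply: le_dist => [|f Ff]; first by case: hF.
  rewrite ler_pdivrMr // lerBlDl; apply: le_trans (err f Ff) _.
  rewrite lerD2l mulrA mulrC ler_wpM2l ?norm_ge0 //.
  by rewrite ler_pM2r // lerDl ler01.
rewrite ler_pdivrMr // lerBlDl => /le_trans; apply.
by rewrite -!mulrA lerD2l mulrCA ler_pM2l ?ltr_wpDl // mulrC.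
Qed.
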